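(* Let $G$ be a connected graph and let $H$ be an arbitrary graph (both finite, undirected, simple, with at least two vertices). Suppose that either $H$ is identifiable and $\Delta(H)\leq |V(H)|-2$, or both $G$ and $H$ are identifiable. (i) If $\Delta(H)\leq|V(H)|-2$, then $$I(G[H])=(|V(G)|-s(G)-t(G))\,I'(H)+s(G)\,I''(H)+t(G)\,I(H).$$ (ii) If $\Delta(H)=|V(H)|-1$, then $$I(G[H])=(|V(G)|-t(G))\,I'(H)+t(G)\,I(H).$$
   Context: All graphs are finite, undirected, simple, with at least two vertices. $V(\Gamma)$ is the vertex set of a graph $\Gamma$, $d_\Gamma(u,v)$ is the distance in $\Gamma$ (infinite if $u,v$ lie in different components), and $\Delta(\Gamma)$ is the maximum degree. For $v\in V(\Gamma)$, $B_\Gamma(v)=\{u\in V(\Gamma): d_\Gamma(u,v)\leq 1\}$ and $N_\Gamma(v)=B_\Gamma(v)\setminus\{v\}$. A code is a nonempty set of vertices. A code $C$ covers $v$ if $B_\Gamma(v)\cap C\neq\emptyset$; it separates two distinct vertices $x,y$ if $B_\Gamma(x)\cap C\neq B_\Gamma(y)\cap C$. An identifying code of $\Gamma$ is a code that covers every vertex of $\Gamma$ and separates every pair of distinct vertices of $\Gamma$. $\Gamma$ is identifiable if it admits at least one identifying code, and then $I(\Gamma)$ denotes the minimum cardinality of an identifying code of $\Gamma$. $I'(H)$ denotes the minimum cardinality of a code $C'\subseteq V(H)$ that separates every pair of distinct vertices of $H$. $I''(H)$ denotes the minimum cardinality of a code $C''\subseteq V(H)$ that separates every pair of distinct vertices of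 $H$ and satisfies $C''\not\subseteq B_H(v)$ for every $v\in V(H)$. The lexicographic product $G[H]$ has vertex set $V(G)\times V(H)$, with $(u_1,v_1)$ and $(u_2,v_2)$ adjacent if and only if $d_G(u_1,u_2)=1$, or $u_1=u_2$ and $d_H(v_1,v_2)=1$. For $u_1,u_2\in V(G)$ define $u_1\equiv u_2$ if and only if $B_G(u_1)=B_G(u_2)$ or $N_G(u_1)=N_G(u_2)$. It is known that $\equiv$ is an equivalence relation and that each equivalence class is either a single vertex, a clique of size at least 2, or an independent set of size at least 2. Denote the equivalence classes by $W_1,\ldots,W_p,U_1,\ldots,U_k,V_1,\ldots,V_l$, where the $W_q$ are the classes of size 1, the $U_i$ are the classes of size at least 2 with $B_G(u_1)=B_G(u_2)$ for all $u_1,u_2\in U_i$, and the $V_j$ are the classes of size at least 2 with $N_G(u_1)=N_G(u_2)$ for all $u_1,u_2\in V_j$ (any of $p,k,l$ may be $0$). Set $s(G)=|U_1|+\cdots+|U_k|-k$ and $t(G)=|V_1|+\cdots+|V_l|-l$. *)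

(* Defs.v *)
From mathcomp Require Import all_boot.
Set Implicit Arguments.
Unset Strict Implicit.
Unset Printing Implicit Defensive.

Record sgraph := SGraph {
  vertex :> finType;
  adj : rel vertex;
  adj_sym : symmetric adj;
  adj_irrefl : irreflexive adj
}.

Section Distance.
Variable Gm : sgraph.
Implicit Types u v : Gm.

Definition is_connected := forall u v, connect (@adj Gm) u v.

Definition walk_of_length n u v :=
  [exists p : n.-tuple Gm, path (@adj Gm) u p && (last u p == v)].

(* Shortest walks have fewer than #|Gm| edges, so the search fails, returning
   #|Gm|, exactly when u and v lie in different components: #|Gm| encodes an
   infinite distance, and two components force 1 < #|Gm|. *)
Definition dist u v :=
  find (fun n => walk_of_length n u v) (iota 0 #|Gm|).

Definition ball v : {set Gm} := [set u | dist u v <= 1].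
Definition nbhd v : {set Gm} := ball v :\ v.

Definition max_degree := \max_(v : Gm) #|nbhd v|.

Lemma walk0E u v : walk_of_length 0 u v = (u == v).
Proof.
apply/existsP/idP => [[p]|uv]; first by rewrite tuple0.
by exists [tuple].
Qed.

Lemma walk1E u v : walk_of_length 1 u v = adj u v.
Proof.
apply/existsP/idP => [[p]|uv].
  by case/tupleP: p => x p; rewrite tuple0 /= andbT => /andP[ux /eqP <-].
by exists [tuple v]; rewrite /= uv eqxx.
Qed.

Lemma distE u v : dist u v =
  if u == v then 0 else if adj u v then 1 else
  (find (fun n => walk_of_length n u v) (iota 2 (#|Gm| - 2))).+2.
Proof.
rewrite /dist; case: eqVneq => [<-|uv].
  have : 0 < #|Gm| by apply/card_gt0P; exists u.
  by case: #|Gm| => //= n; rewrite walk0E eqxx.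
have : 1 < #|Gm|.
  by apply/card_gt1P; exists u, v.
case: #|Gm| => [|[|n]] //= _.
by rewrite walk0E (negPf uv) walk1E !subSS subn0; case: (adj u v).
Qed.

Lemma dist_le1 u v : (dist u v <= 1) = (u == v) || adj u v.
Proof. by rewrite distE; case: (u == v) => //=; case: (adj u v). Qed.

Lemma dist_eq1 u v : (dist u v == 1) = adj u v.
Proof.
rewrite distE; case: (eqVneq u v) => [<-|_]; last by case: (adj u v).
by rewrite adj_irrefl.
Qed.

Lemma dist_eq1_sym : symmetric (fun u v => dist u v == 1).
Proof. by move=> u v; rewrite !dist_eq1 adj_sym. Qed.

Lemma dist_eq1_irrefl : irreflexive (fun u v => dist u v == 1).
Proof. by move=> u; rewrite dist_eq1 adj_irrefl. Qed.

End Distance.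

Section Codes.
Variable Gm : sgraph.
Implicit Types (C : {set Gm}) (x y v : Gm).

Definition code C := C != set0.
Definition covers C v := ball v :&: C != set0.
Definition separates C x y := ball x :&: C != ball y :&: C.

Definition covers_all C := [forall v, covers C v].
Definition separates_all C :=
  [forall x, forall y, (x != y) ==> separates C x y].

Definition identifying_code C := [&& code C, covers_all C & separates_all C].
Definition separating_code C := code C && separates_all C.
Definition separating_unbounded_code C :=
  separating_code C && [forall v, ~~ (C \subset ball v)].

Definition identifiable := [exists C, identifying_code C].

End Codes.

(* Minimum cardinality of a set satisfying P; when no set satisfies P the
   arg min is [set: T], so the value #|T| is then meaningless. *)
Definition min_card (T : finType) (P : pred {set T}) : nat :=
  #|[arg min_(C < [set: T] | P C) #|C| ]|.

Definition Inum (Gm : sgraph) := min_card (@identifying_code Gm).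
Definition Inum' (Gm : sgraph) := min_card (@separating_code Gm).
Definition Inum'' (Gm : sgraph) := min_card (@separating_unbounded_code Gm).

Section LexicographicProduct.
Variables G H : sgraph.

Definition lex_adj : rel (G * H) := fun x y =>
  (dist x.1 y.1 == 1) || ((x.1 == y.1) && (dist x.2 y.2 == 1)).

Fact lex_adj_sym : symmetric lex_adj.
Proof.
by move=> x y; rewrite /lex_adj dist_eq1_sym [_.1 == _]eq_sym [dist x.2 _ == _]dist_eq1_sym.
Qed.

Fact lex_adj_irrefl : irreflexive lex_adj.
Proof. by move=> x; rewrite /lex_adj !dist_eq1_irrefl andbF. Qed.

Definition lexprod : sgraph := SGraph lex_adj_sym lex_adj_irrefl.

End LexicographicProduct.

Section TwinClasses.
Variable G : sgraph.

Definition twin : rel G := fun u1 u2 =>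
  (ball u1 == ball u2) || (nbhd u1 == nbhd u2).

Definition twin_classes : {set {set G}} :=
  equivalence_partition twin [set: G].

Definition U_classes : {set {set G}} :=
  [set U in twin_classes | (2 <= #|U|) &&
     [forall u1 in U, forall u2 in U, ball u1 == ball u2]].

Definition V_classes : {set {set G}} :=
  [set V in twin_classes | (2 <= #|V|) &&
     [forall u1 in V, forall u2 in V, nbhd u1 == nbhd u2]].

Definition s_num := (\sum_(U in U_classes) #|U|) - #|U_classes|.
Definition t_num := (\sum_(V in V_classes) #|V|) - #|V_classes|.

End TwinClasses.

(* Main.v *)
Require Import Defs.
From mathcomp Require Import all_boot.

Set Implicit Arguments.
Unset Strict Implicit.
Unset Printing Implicit Defensive.

(** Cut a code C of G[H] into its layers C_u = {x | (u, x) in C}. The ball of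
    (u, x) contains all of the layer over each neighbour of u, the ball of x
    over u itself, and nothing over the other vertices. Hence:

    - Two vertices over the same u are separated by C exactly when C_u
      separates their H-coordinates, so every layer must be a separating code
      of H. Layers are then nonempty, and since G is connected with at least
      two vertices, every u has a neighbour, whose layer makes C cover (u, x).
    - Vertices (u1, x) and (u2, y) with u1 <> u2 can only fail to be separated
      when u1 and u2 are twins, since the nonempty layers reveal the
      neighbours of u1 and u2. For true twins (equal balls) failure means that
      C_u1 lies in the ball of x and C_u2 in the ball of y; for false twins
      (equal neighbourhoods) it means that C_u1 misses the ball of x and C_u2
      misses the ball of y ([lex_trace_twin]).

    So C is identifying if and only if all layers separate H, at most one
    layer in each class of true twins is contained in a ball, and at most one
    layer in each class of false twins fails to cover H
    ([identifying_layersP]). These conditions can be optimised class by class: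
    a class A costs I' for one exceptional vertex, plus |A| - 1 times I'' (true
    twins) or I (false twins). The lower bound is [class_weight_lower], and
    [optimal_layers] attains it. Summing over the |V(G)| - s(G) - t(G) classes
    gives the formula of (i). The existence of a code that is not contained in
    a ball matters only when G has true twins, and the hypotheses then force
    the maximum degree of H to be at most |V(H)| - 2. In (ii) they force G to
    be identifiable, so that s(G) = 0 and the same formula applies. *)

(** * Minimum cardinality *)

Section MinCard.
Variables (T : finType) (P : pred {set T}).

Definition min_set : {set T} := [arg min_(C < [set: T] | P C) #|C| ].

(** The arg min starts from [set: T], which need not satisfy P; a witness C0
    is enough for the search to succeed. *)
Lemma min_setP (C0 : {set T}) : P C0 ->
  P min_set /\ forall C, P C -> min_card P <= #|C|.
Proof.
move=> PC0; rewrite /min_card /min_set /arg_min /extremum.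
case: pickP => [C /andP[PC /forallP minC] | none] /=.
  by split=> // D PD; move: (minC D); rewrite PD.
case: (arg_minnP (fun C : {set T} => #|C|) PC0) => C PC minC.
by case/idP: (none C); rewrite /= PC; apply/forallP=> D; apply/implyP/minC.
Qed.

End MinCard.

(** At most one index escapes the bound b; the bound a then takes over there. *)
Lemma sum_all_but_one (T : finType) (A : {set T}) (P : pred T) (f : T -> nat)
    a b :
    0 < #|A| -> {in A, forall i, a <= f i} ->
    {in A, forall i, P i -> b <= f i} ->
    {in A &, forall i j, i != j -> P i || P j} ->
  a + #|A|.-1 * b <= \sum_(i in A) f i.
Proof.
move=> /card_gt0P[i0 i0A] le_a le_b PA.
have [i iA Pi] : exists2 i, i \in A & {in A, forall j, j != i -> P j}.
  have [/exists_inP[i iA nPi] | /exists_inPn noP] :=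
    boolP [exists i in A, ~~ P i].
    exists i => // j jA ji; move: (PA i j iA jA).
    by rewrite eq_sym ji (negPf nPi); apply.
  by exists i0 => // j jA _; move: (noP j jA); rewrite negbK.
rewrite (big_setD1 i) //= leq_add ?le_a //.
rewrite (cardsD1 i) iA /= -sum_nat_const; apply: leq_sum => j.
by rewrite in_setD1 => /andP[ji jA]; apply/le_b/Pi.
Qed.

(** * Balls, codes and twins *)

Section Graph.
Variable Gm : sgraph.
Implicit Types (u v w x y : Gm) (C D : {set Gm}).

Lemma in_ball u v : (u \in ball v) = (u == v) || adj u v.
Proof. by rewrite inE dist_le1. Qed.

Lemma in_nbhd u v : (u \in nbhd v) = adj u v.
Proof.
rewrite in_setD1 in_ball; case: (eqVneq u v) => //= ->.
by rewrite adj_irrefl.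
Qed.

Definition unbounded C := [forall v, ~~ (C \subset ball v)].

Lemma separates_allP C :
  reflect (forall x y, ball x :&: C = ball y :&: C -> x = y) (separates_all C).
Proof.
apply: (iffP forallP) => [sep x y eqC | sep x].
  apply/eqP; apply: contraT => xy.
  by move/forallP/(_ y): (sep x); rewrite xy /separates eqC eqxx.
apply/forallP=> y; apply/implyP; apply: contra => /eqP eqC.
by apply/eqP/sep.
Qed.

Lemma separates_all_neq0 C : 2 <= #|Gm| -> separates_all C -> C != set0.
Proof.
move=> /card_gt1P[x [y [_ _ /eqP xy]]] /separates_allP sep.
by apply: contra_not_neq xy => C0; apply: sep; rewrite C0 !setI0.
Qed.

Lemma identifying_covers C : identifying_code C -> covers_all C.
Proof. by case/and3P. Qed.

Lemma identifying_separates C : identifying_code C -> separates_all C.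
Proof. by case/and3P. Qed.

Lemma identifiable_ball_inj : identifiable Gm -> injective (@ball Gm).
Proof.
case/existsP=> C /identifying_separates/separates_allP sep x y eqB.
by apply: sep; rewrite eqB.
Qed.

Lemma ball_inj_separatesT : injective (@ball Gm) -> separates_all [set: Gm].
Proof. by move=> inj; apply/separates_allP => x y; rewrite !setIT => /inj. Qed.

Lemma unboundedT :
  2 <= #|Gm| -> max_degree Gm <= #|Gm| - 2 -> unbounded [set: Gm].
Proof.
move=> cardGm degGm; apply/forallP=> v; apply/negP => /subset_leq_card.
rewrite cardsT (cardsD1 v) in_ball eqxx /= -/(nbhd v).
have: #|nbhd v| <= #|Gm| - 2.
  exact: leq_trans (leq_bigmax (F := fun w : Gm => #|nbhd w|) v) degGm.
case: #|Gm| cardGm => [|[|n]] // _; rewrite !subSS subn0 add1n ltnS.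
by move=> ltN /leq_trans/(_ ltN); rewrite ltnn.
Qed.

Lemma ball_eq_adj u v : u != v -> ball u = ball v -> adj u v.
Proof. by move=> uv /setP/(_ u); rewrite !in_ball eqxx (negPf uv). Qed.

Lemma nbhd_eq_nadj u v : nbhd u = nbhd v -> ~~ adj u v.
Proof. by move/setP/(_ u); rewrite !in_nbhd adj_irrefl => <-. Qed.

(** Three vertices cannot mix the two kinds of twins: a vertex w with the
    neighbours of v, where v is a true twin of u, is adjacent to u and hence
    to v, its own false twin. *)
Lemma true_false_twin u v w :
  ball u = ball v -> nbhd v = nbhd w -> u = v \/ v = w.
Proof.
move=> eqB eqN; case: (eqVneq u v) => [|uv]; [by left | right].
have uw : adj w u.
  by rewrite adj_sym -in_nbhd -eqN in_nbhd ball_eq_adj.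
have : w \in ball v by rewrite -eqB in_ball uw orbT.
rewrite in_ball => /orP[/eqP-> // |].
by rewrite adj_sym (negPf (nbhd_eq_nadj eqN)).
Qed.

Lemma twin_equivalence : {in [set: Gm] & &, equivalence_rel (@twin Gm)}.
Proof.
have twin_sym : symmetric (@twin Gm).
  by move=> u v; rewrite /twin eq_sym [nbhd u == _]eq_sym.
have twin_trans : transitive (@twin Gm).
  move=> v u w; rewrite /twin.
  case/orP=> /eqP uv /orP[] /eqP vw.
  - by rewrite uv vw eqxx.
  - by case: (true_false_twin uv vw) => [->|<-]; rewrite ?vw ?uv eqxx ?orbT.
  - case: (true_false_twin (esym vw) (esym uv)) => [->|<-];
    by rewrite ?vw ?uv eqxx ?orbT.
  - by rewrite uv vw eqxx orbT.
move=> u v w _ _ _; split; first by rewrite /twin eqxx.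
move=> uv; apply/idP/idP; last exact: twin_trans.
by apply: twin_trans; rewrite twin_sym.
Qed.

Lemma twin_classes_partition : partition (twin_classes Gm) [set: Gm].
Proof. exact/equivalence_partitionP/twin_equivalence. Qed.

Definition twin_class u := pblock (twin_classes Gm) u.

Lemma in_twin_class u v : (v \in twin_class u) = twin u v.
Proof.
by rewrite /twin_class (pblock_equivalence_partition twin_equivalence) ?inE.
Qed.

Lemma twin_class_in u : twin_class u \in twin_classes Gm.
Proof.
by apply: pblock_mem; rewrite (cover_partition twin_classes_partition) inE.
Qed.

Lemma mem_twin_class A u : A \in twin_classes Gm -> u \in A -> twin_class u = A.
Proof.
by move=> AP uA; apply: def_pblock => //; case/and3P: twin_classes_partition.
Qed.

Lemma twin_class_eq u v : twin u v -> twin_class u = twin_class v.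
Proof.
rewrite -in_twin_class => vu; apply/esym/mem_twin_class => //.
exact: twin_class_in.
Qed.

Lemma true_twin_class u v :
  u != v -> ball u = ball v -> twin_class u \in U_classes Gm.
Proof.
move=> uv eqB; rewrite inE twin_class_in /=; apply/andP; split.
  by apply/card_gt1P; exists u, v; rewrite !in_twin_class /twin eqB !eqxx.
have all_u w : w \in twin_class u -> ball w = ball u.
  rewrite in_twin_class => /orP[/eqP // | /eqP eqN].
  case: (true_false_twin (esym eqB) eqN) => [vu|-> //].
  by rewrite vu eqxx in uv.
by apply/forall_inP=> w1 w1u; apply/forall_inP=> w2 w2u; rewrite !all_u.
Qed.

Lemma false_twin_class u v :
  u != v -> nbhd u = nbhd v -> twin_class u \in V_classes Gm.
Proof.
move=> uv eqN; rewrite inE twin_class_in /=; apply/andP; split.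
  by apply/card_gt1P; exists u, v; rewrite !in_twin_class /twin eqN !eqxx !orbT.
have all_u w : w \in twin_class u -> nbhd w = nbhd u.
  rewrite in_twin_class => /orP[/eqP eqB | /eqP //].
  case: (true_false_twin (esym eqB) eqN) => [-> //|uv'].
  by rewrite uv' eqxx in uv.
by apply/forall_inP=> w1 w1u; apply/forall_inP=> w2 w2u; rewrite !all_u.
Qed.

Lemma U_class_ball A u v :
  A \in U_classes Gm -> u \in A -> v \in A -> ball u = ball v.
Proof.
rewrite inE => /and3P[_ _ /forall_inP eqA] uA vA.
by move/forall_inP/(_ v vA)/eqP: (eqA u uA).
Qed.

Lemma V_class_nbhd A u v :
  A \in V_classes Gm -> u \in A -> v \in A -> nbhd u = nbhd v.
Proof.
rewrite inE => /and3P[_ _ /forall_inP eqA] uA vA.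
by move/forall_inP/(_ v vA)/eqP: (eqA u uA).
Qed.

Lemma UV_disjoint A : A \in U_classes Gm -> A \notin V_classes Gm.
Proof.
move=> AU; apply/negP=> AV.
have: 1 < #|A| by move: AU; rewrite inE => /and3P[].
case/card_gt1P=> u [v [uA vA uv]].
have := nbhd_eq_nadj (V_class_nbhd AV uA vA).
by rewrite (ball_eq_adj uv (U_class_ball AU uA vA)).
Qed.

Lemma card_twin_class_gt0 A : A \in twin_classes Gm -> 0 < #|A|.
Proof.
have [_ _ P0] := and3P twin_classes_partition.
by move=> AP; rewrite card_gt0; apply: contraNneq P0 => <-.
Qed.

Lemma singleton_class A :
  A \in twin_classes Gm -> A \notin U_classes Gm -> A \notin V_classes Gm ->
  #|A| = 1.
Proof.
move=> AP AU AV; apply/eqP; rewrite eqn_leq card_twin_class_gt0 // andbT.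
rewrite leqNgt; apply/negP=> /card_gt1P[u [v [uA vA uv]]].
have: twin u v by rewrite -in_twin_class (mem_twin_class AP uA).
case/orP=> /eqP.
  by move/(true_twin_class uv); rewrite (mem_twin_class AP uA) (negPf AU).
by move/(false_twin_class uv); rewrite (mem_twin_class AP uA) (negPf AV).
Qed.

Lemma s_numE : s_num Gm = \sum_(A in U_classes Gm) #|A|.-1.
Proof.
rewrite /s_num -sum1_card -sumnB.
  by apply: eq_bigr => A _; rewrite subn1.
by move=> A; rewrite inE => /andP[AP _]; apply: card_twin_class_gt0.
Qed.

Lemma t_numE : t_num Gm = \sum_(A in V_classes Gm) #|A|.-1.
Proof.
rewrite /t_num -sum1_card -sumnB.
  by apply: eq_bigr => A _; rewrite subn1.
by move=> A; rewrite inE => /andP[AP _]; apply: card_twin_class_gt0.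
Qed.

Lemma sum_by_class (f : Gm -> nat) :
  \sum_u f u = \sum_(A in twin_classes Gm) \sum_(u in A) f u.
Proof.
have /and3P[/eqP covP tI _] := twin_classes_partition.
by rewrite -big_trivIset // covP; apply: eq_bigl => u; rewrite inE.
Qed.

(** Singleton classes contribute only a, since then #|A|.-1 = 0 and the
    weight is 0; this is how a bound summed class by class turns into s and t. *)
Lemma sum_twin_classes a b c :
  \sum_(A in twin_classes Gm)
     (a + #|A|.-1 * (if A \in U_classes Gm then b else
                     if A \in V_classes Gm then c else 0)) =
  #|twin_classes Gm| * a + s_num Gm * b + t_num Gm * c.
Proof.
rewrite big_split /= sum_nat_const -addnA; congr (_ + _).
rewrite s_numE t_numE !big_distrl /=.
have -> : \sum_(A in U_classes Gm) #|A|.-1 * b =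
          \sum_(A in twin_classes Gm | A \in U_classes Gm) #|A|.-1 * b.
  by apply: eq_bigl => A; rewrite andb_idl // inE => /andP[].
have -> : \sum_(A in V_classes Gm) #|A|.-1 * c =
          \sum_(A in twin_classes Gm | A \in V_classes Gm) #|A|.-1 * c.
  by apply: eq_bigl => A; rewrite andb_idl // inE => /andP[].
rewrite !big_mkcondr -big_split; apply: eq_bigr => A _ /=.
case: ifP => [AU|_]; first by rewrite (negPf (UV_disjoint AU)) addn0.
by case: ifP; rewrite ?muln0.
Qed.

Lemma card_twin_classes : #|twin_classes Gm| = #|Gm| - s_num Gm - t_num Gm.
Proof.
suff -> : #|Gm| = #|twin_classes Gm| + s_num Gm + t_num Gm.
  by rewrite -subnDA -addnA addnK.
rewrite -cardsT (card_partition twin_classes_partition).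
have := sum_twin_classes 1 1 1; rewrite !muln1 => <-.
apply: eq_bigr => A AP; have /prednK := card_twin_class_gt0 AP.
case: ifP => [_|/negbT AU]; first by rewrite muln1.
case: ifP => [_|/negbT AV]; first by rewrite muln1.
by rewrite (singleton_class AP AU AV).
Qed.

Lemma ball_inj_s_num : injective (@ball Gm) -> s_num Gm = 0.
Proof.
move=> inj; rewrite s_numE big_pred0 // => A; apply/negP=> AU.
have: 1 < #|A| by move: AU; rewrite inE => /and3P[].
case/card_gt1P=> u [v [uA vA /eqP]]; apply.
exact/inj/(U_class_ball AU).
Qed.

End Graph.

(** * Codes of a lexicographic product, layer by layer *)

Section Layers.
Variables G H : sgraph.
Implicit Types (C : {set lexprod G H}) (F : G -> {set H}) (u v w : G).
Implicit Types (x y z : H).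

Definition layer C u : {set H} := [set x | ((u, x) : lexprod G H) \in C].
Definition of_layers F : {set lexprod G H} := [set p | p.2 \in F p.1].

Lemma in_layer C u x : (x \in layer C u) = (((u, x) : lexprod G H) \in C).
Proof. by rewrite inE. Qed.

Lemma of_layersK F : layer (of_layers F) =1 F.
Proof. by move=> u; apply/setP=> x; rewrite !inE. Qed.

Lemma card_layers C : #|C| = \sum_u #|layer C u|.
Proof.
rewrite -sum1_card big_mkcond /=.
rewrite (eq_bigr (fun u => \sum_x if (u, x) \in C then 1 else 0)); last first.
  by move=> u _; rewrite -sum1_card big_mkcond; apply: eq_bigr => x _; rewrite inE.
by rewrite pair_bigA /=; apply: eq_bigr => -[].
Qed.

Lemma in_lex_ball u w x y :
  ((w, y) \in @ball (lexprod G H) (u, x)) =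
  adj w u || (w == u) && (y \in ball x).
Proof.
rewrite [LHS]in_ball /= /lex_adj /= !dist_eq1 in_ball xpair_eqE.
by case: (w == u); rewrite ?orbF //= orbCA.
Qed.

Lemma lex_trace_same u x y C :
  (@ball (lexprod G H) (u, x) :&: C == @ball (lexprod G H) (u, y) :&: C) =
  (ball x :&: layer C u == ball y :&: layer C u).
Proof.
apply/eqP/eqP => /setP eqC; apply/setP.
  move=> z; move: (eqC (u, z)).
  by rewrite !in_setI !in_lex_ball !in_layer adj_irrefl eqxx.
case=> w z; rewrite !in_setI !in_lex_ball.
case: (eqVneq w u) => [->|//]; move: (eqC z).
by rewrite !in_setI in_layer adj_irrefl.
Qed.

(** Every layer being nonempty, the trace of a ball over a vertex w away from
    u1 and u2 tells whether w is a neighbour, so equal traces force u1 and u2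
    to be twins. Over u1, one trace is that of the ball of x and the other is
    the whole layer or nothing, according to whether u1 and u2 are adjacent;
    likewise over u2. *)
Lemma lex_trace_twin u1 u2 x y C :
    (forall w, layer C w != set0) -> u1 != u2 ->
  @ball (lexprod G H) (u1, x) :&: C = @ball (lexprod G H) (u2, y) :&: C <->
  [/\ ball u1 = ball u2, layer C u1 \subset ball x & layer C u2 \subset ball y]
  \/ [/\ nbhd u1 = nbhd u2, ~~ covers (layer C u1) x & ~~ covers (layer C u2) y].
Proof.
move=> C_neq0 u12; split=> [eqC | ].
  have eqC' w z : (w, z) \in C -> adj w u1 || (w == u1) && (z \in ball x) =
                                  adj w u2 || (w == u2) && (z \in ball y).
    move=> Cwz; move/setP/(_ (w, z)): eqC.
    by rewrite !in_setI Cwz !andbT !in_lex_ball.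
  have eq_off w : w != u1 -> w != u2 -> adj w u1 = adj w u2.
    move=> /negPf wu1 /negPf wu2; have /set0Pn[z] := C_neq0 w.
    by rewrite inE => /eqC'; rewrite wu1 wu2 !orbF.
  have eq1 z : z \in layer C u1 -> (z \in ball x) = adj u1 u2.
    by rewrite inE => /eqC'; rewrite adj_irrefl eqxx (negPf u12) orbF.
  have eq2 z : z \in layer C u2 -> (z \in ball y) = adj u1 u2.
    rewrite inE => /eqC'.
    by rewrite adj_irrefl eqxx eq_sym (negPf u12) orbF adj_sym => ->.
  case adj12: (adj u1 u2); [left | right]; split.
  - apply/setP=> w; rewrite !in_ball.
    case: (eqVneq w u1) => [->|wu1]; first by rewrite adj12 orbT.
    case: (eqVneq w u2) => [->|wu2]; first by rewrite adj_sym adj12.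
    exact: eq_off.
  - by apply/subsetP=> z /eq1; rewrite adj12.
  - by apply/subsetP=> z /eq2; rewrite adj12.
  - apply/setP=> w; rewrite !in_nbhd.
    case: (eqVneq w u1) => [->|wu1]; first by rewrite adj_irrefl adj12.
    case: (eqVneq w u2) => [->|wu2]; first by rewrite adj_irrefl adj_sym adj12.
    exact: eq_off.
  - apply/negPn/eqP/setP=> z; rewrite in_setI in_set0 andbC.
    by apply/andP=> -[/eq1->]; rewrite adj12.
  - apply/negPn/eqP/setP=> z; rewrite in_setI in_set0 andbC.
    by apply/andP=> -[/eq2->]; rewrite adj12.
case=> [[eqB /subsetP sub1 /subsetP sub2] | [eqN /negPn/eqP dis1 /negPn/eqP dis2]];
  apply/setP=> -[w z]; rewrite !in_setI !in_lex_ball;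
  case Cwz: ((w, z) \in C); rewrite ?andbF // !andbT.
  have adj12 := ball_eq_adj u12 eqB.
  case: (eqVneq w u1) => [eqw|wu1].
    by rewrite eqw adj_irrefl adj12 sub1 // inE -eqw.
  case: (eqVneq w u2) => [eqw|wu2].
    by rewrite eqw adj_sym adj12 sub2 ?orbT // inE -eqw.
  by move/setP/(_ w): eqB; rewrite !in_ball (negPf wu1) (negPf wu2) !orbF.
have -> : adj w u1 = adj w u2 by rewrite -!in_nbhd eqN.
congr (_ || _); transitivity false.
  apply/andP=> -[/eqP eqw zx]; move/setP/(_ z): dis1.
  by rewrite in_setI zx inE -eqw Cwz inE.
apply/esym/andP=> -[/eqP eqw zy]; move/setP/(_ z): dis2.
by rewrite in_setI zy inE -eqw Cwz inE.
Qed.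

Definition good_layers F :=
  [/\ forall u, separates_all (F u),
      forall u v, u != v -> ball u = ball v -> unbounded (F u) || unbounded (F v) &
      forall u v, u != v -> nbhd u = nbhd v -> covers_all (F u) || covers_all (F v)].

Hypotheses (cardG : 2 <= #|G|) (cardH : 2 <= #|H|) (connG : is_connected G).

Lemma connected_neighbour u : exists v, adj v u.
Proof.
have [v vu] : exists v, v != u.
  have /card_gt1P[a [b [_ _ ab]]] := cardG.
  case: (eqVneq a u) => [au|]; last by exists a.
  by exists b; rewrite eq_sym -au.
have /connectP[[|w p] /=] := connG u v.
  by move=> _ vu'; rewrite vu' eqxx in vu.
by case/andP=> uw _ _; exists w; rewrite adj_sym.
Qed.

(** Covering costs nothing beyond separation: a neighbour of u carries a
    nonempty layer, contained in the ball of every (u, x). The two twin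
    conditions rule out exactly the failures listed in [lex_trace_twin]. *)
Lemma identifying_layersP C : identifying_code C <-> good_layers (layer C).
Proof.
split=> [/and3P[_ _ /separates_allP sepC] | [sepF unbF covF]].
  have sepF u : separates_all (layer C u).
    apply/separates_allP=> x y /eqP; rewrite -lex_trace_same => /eqP /sepC.
    by case.
  have F_neq0 u : layer C u != set0 by apply: separates_all_neq0.
  split=> // u v uv eqBN.
    apply: contraT; rewrite negb_or !negb_forall.
    case/andP=> /existsP[x /negPn sub1] /existsP[y /negPn sub2].
    have [] : (u, x) = (v, y) by apply/sepC/lex_trace_twin => //; left.
    by move/eqP; rewrite (negPf uv).
  apply: contraT; rewrite negb_or !negb_forall.
  case/andP=> /existsP[x cov1] /existsP[y cov2].
  have [] : (u, x) = (v, y) by apply/sepC/lex_trace_twin => //; right.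
  by move/eqP; rewrite (negPf uv).
have F_neq0 u : layer C u != set0 by apply: separates_all_neq0.
have cov_C : covers_all C.
  apply/forallP=> -[u x]; have [v vu] := connected_neighbour u.
  have /set0Pn[y] := F_neq0 v; rewrite inE => Cvy.
  by apply/set0Pn; exists (v, y); rewrite in_setI in_lex_ball vu Cvy.
apply/and3P; split=> //.
  have /card_gt0P[u _] := ltnW cardG; have /set0Pn[x] := F_neq0 u.
  by rewrite inE => Cux; apply/set0Pn; exists (u, x).
apply/separates_allP => -[u x] [v y].
case: (eqVneq u v) => [<- /eqP|uv].
  by rewrite lex_trace_same => /eqP/(separates_allP _ (sepF u)) ->.
case/(lex_trace_twin _ _ F_neq0 uv) => -[eqBN subx suby]; exfalso.
  case/orP: (unbF u v uv eqBN) => /forallP.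
    by move/(_ x)/negP.
  by move/(_ y)/negP.
case/orP: (covF u v uv eqBN) => /forallP.
  by move/(_ x); rewrite (negPf subx).
by move/(_ y); rewrite (negPf suby).
Qed.

(** * Optimal layers *)

Let K : {set H} := min_set (@separating_code H).
Let K_unb : {set H} := min_set (@separating_unbounded_code H).
Let K_cov : {set H} := min_set (@identifying_code H).

Hypotheses (idH : identifiable H)
  (degH : forall u v : G, u != v -> ball u = ball v -> max_degree H <= #|H| - 2).

Lemma separating_codeE (D : {set H}) : separating_code D = separates_all D.
Proof.
rewrite /separating_code /code; case: (boolP (separates_all D)); rewrite ?andbF //.
by move/separates_all_neq0 ->.
Qed.

Let separatesT : separates_all [set: H].
Proof. exact/ball_inj_separatesT/identifiable_ball_inj. Qed.

Let K_sep : separates_all K /\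
  forall D : {set H}, separates_all D -> Inum' H <= #|D|.
Proof.
have [|PK minK] := @min_setP _ (@separating_code H) [set: H].
  by rewrite separating_codeE.
by rewrite -separating_codeE; split=> // D; rewrite -separating_codeE => /minK.
Qed.

Let K_cov_id : identifying_code K_cov /\
  forall D : {set H}, separates_all D -> covers_all D -> Inum H <= #|D|.
Proof.
have [D0 idD0] := existsP idH; have [PK minK] := min_setP idD0.
split=> // D sepD covD; apply: minK.
by rewrite /identifying_code covD sepD /code separates_all_neq0.
Qed.

(** The degree bound is what keeps the whole vertex set of H out of every ball,
    so that the minimum defining I'' is attained. *)
Let K_unb_sep : max_degree H <= #|H| - 2 ->
  [/\ separates_all K_unb, unbounded K_unb &
   forall D : {set H}, separates_all D -> unbounded D -> Inum'' H <= #|D|].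
Proof.
move=> deg2.
have [|PK minK] := @min_setP _ (@separating_unbounded_code H) [set: H].
  rewrite /separating_unbounded_code separating_codeE separatesT.
  exact: unboundedT.
move: PK; rewrite /separating_unbounded_code separating_codeE => /andP[sepK unbK].
split=> // D sepD unbD; apply: minK.
by rewrite /separating_unbounded_code separating_codeE sepD.
Qed.

Let U_class_deg A : A \in U_classes G -> max_degree H <= #|H| - 2.
Proof.
move=> AU; have: 1 < #|A| by move: AU; rewrite inE => /and3P[].
by case/card_gt1P=> u [v [uA vA uv]]; apply: degH uv (U_class_ball AU uA vA).
Qed.

(** The price of each vertex of A beyond the exceptional one. A class that
    is neither a U nor a V is a singleton, hence has no such vertex. *)
Let class_weight (A : {set G}) :=
  if A \in U_classes G then Inum'' H else
  if A \in V_classes G then Inum H else 0.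

(** [good_layers] leaves at most one vertex of A whose layer is contained in a
    ball (true twins) or fails to cover H (false twins). *)
Lemma class_weight_lower F A : good_layers F -> A \in twin_classes G ->
  Inum' H + #|A|.-1 * class_weight A <= \sum_(u in A) #|F u|.
Proof.
case=> sepF unbF covF AP; rewrite /class_weight.
have minF u : Inum' H <= #|F u| by have [_] := K_sep; apply.
have A0 := card_twin_class_gt0 AP.
case: ifP => [AU|_].
  have [_ _ minU] := K_unb_sep (U_class_deg AU).
  apply: (@sum_all_but_one _ _ (fun u => unbounded (F u))) => // u.
    by move=> _; apply: minU.
  by move=> v uA vA uv; apply: unbF => //; apply: U_class_ball AU _ _.
case: ifP => [AV|_].
  have [_ minV] := K_cov_id.
  apply: (@sum_all_but_one _ _ (fun u => covers_all (F u))) => // u.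
    by move=> _; apply: minV.
  by move=> v uA vA uv; apply: covF => //; apply: V_class_nbhd AV _ _.
by apply: (@sum_all_but_one _ _ predT).
Qed.

(** The exceptional vertex of A. An option avoids asking for a default vertex
    of G; the value is never None on a twin class. *)
Let class_rep (A : {set G}) : option G := [pick u in A].

Definition optimal_layers u : {set H} :=
  let A := twin_class u in
  if class_rep A == Some u then K else
  if A \in U_classes G then K_unb else
  if A \in V_classes G then K_cov else K.

Lemma optimal_layers_good : good_layers optimal_layers.
Proof.
have [sepK _] := K_sep.
have [/identifying_separates sepV _] := K_cov_id.
have [/identifying_covers covV _] := K_cov_id.
have rep_uniq u v : u != v -> twin_class u = twin_class v ->
    (class_rep (twin_class u) != Some u) || (class_rep (twin_class v) != Some v).
  by move=> uv ->; rewrite -negb_and; apply: contra uv => /andP[/eqP-> /eqP[->]].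
split=> [u | u v uv eqB | u v uv eqN]; rewrite /optimal_layers.
- case: ifP => // _; case: ifP => [/U_class_deg/K_unb_sep[] // | _].
  by case: ifP.
- have uU := true_twin_class uv eqB.
  have [_ unbU _] := K_unb_sep (U_class_deg uU).
  have eqA : twin_class u = twin_class v.
    by apply: twin_class_eq; rewrite /twin eqB eqxx.
  by case/orP: (rep_uniq u v uv eqA) => /negPf ->; rewrite -?eqA uU unbU ?orbT.
- have uV := false_twin_class uv eqN.
  have uU : twin_class u \notin U_classes G by apply: contraL uV => /UV_disjoint.
  have eqA : twin_class u = twin_class v.
    by apply: twin_class_eq; rewrite /twin eqN eqxx orbT.
  case/orP: (rep_uniq u v uv eqA) => /negPf ->;
  by rewrite -?eqA (negPf uU) uV covV ?orbT.
Qed.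

Lemma optimal_layers_weight A : A \in twin_classes G ->
  \sum_(u in A) #|optimal_layers u| = Inum' H + #|A|.-1 * class_weight A.
Proof.
move=> AP; have [r rA repA] : exists2 r, r \in A & class_rep A = Some r.
  rewrite /class_rep; case: pickP => [r rA|A0]; first by exists r.
  by have := card_twin_class_gt0 AP; rewrite (eq_card0 A0).
rewrite (big_setD1 r) //= {1}/optimal_layers (mem_twin_class AP rA) repA eqxx.
congr (_ + _); rewrite (cardsD1 r) rA add1n /=.
have [A1|[v]] := set_0Vmem (A :\ r); first by rewrite A1 big_set0 cards0.
rewrite in_setD1 => /andP[vr vA].
have big : A \notin U_classes G -> A \in V_classes G.
  move=> AU; apply: contraT => AV; have := singleton_class AP AU AV.
  by rewrite (cardsD1 r) rA (cardsD1 v) in_setD1 vr vA.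
rewrite -sum_nat_const; apply: eq_bigr => u; rewrite in_setD1 => /andP[ur uA].
rewrite /optimal_layers (mem_twin_class AP uA) repA.
case: eqP => [[ru]|_]; first by rewrite ru eqxx in ur.
by rewrite /class_weight; case: ifP => // /negbT /big ->.
Qed.

Lemma lexprod_min :
  identifiable (lexprod G H) /\
  Inum (lexprod G H) =
    (#|G| - s_num G - t_num G) * Inum' H + s_num G * Inum'' H + t_num G * Inum H.
Proof.
have idO : identifying_code (of_layers optimal_layers).
  apply/identifying_layersP; have [sepO unbO covO] := optimal_layers_good.
  by split=> [u | u v | u v]; rewrite !of_layersK; auto.
split; first by apply/existsP; exists (of_layers optimal_layers).
have [idM minM] := min_setP idO.
rewrite -card_twin_classes -sum_twin_classes.
apply/eqP; rewrite eqn_leq; apply/andP; split.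
  apply: leq_trans (minM _ idO) _; rewrite card_layers sum_by_class.
  apply: leq_sum => A AP; rewrite -(optimal_layers_weight AP).
  by apply: leq_sum => u _; rewrite of_layersK.
rewrite [leqRHS](card_layers (min_set (@identifying_code _))) sum_by_class.
by apply: leq_sum => A AP; apply: class_weight_lower => //; apply/identifying_layersP.
Qed.

End Layers.

Theorem theorem3p4 (G H : sgraph) (cardG : 2 <= #|G|) (cardH : 2 <= #|H|)
    (connG : is_connected G)
    (hyp : (identifiable H /\ max_degree H <= #|H| - 2) \/
           (identifiable G /\ identifiable H)) :
  identifiable (lexprod G H) /\
  (max_degree H <= #|H| - 2 ->
     Inum (lexprod G H) =
       (#|G| - s_num G - t_num G) * Inum' H + s_num G * Inum'' H
         + t_num G * Inum H) /\
  (max_degree H = #|H| - 1 ->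
     Inum (lexprod G H) = (#|G| - t_num G) * Inum' H + t_num G * Inum H).
Proof.
have idH : identifiable H by case: hyp => -[].
have degH (u v : G) : u != v -> ball u = ball v -> max_degree H <= #|H| - 2.
  case: hyp => [[] // | [/identifiable_ball_inj inj _] /eqP uv /inj //].
have [idGH ->] := lexprod_min cardG cardH connG idH degH.
split=> //; split=> // deg1.
have s0 : s_num G = 0.
  apply: ball_inj_s_num; case: hyp => [[_] | [/identifiable_ball_inj //]].
  by rewrite deg1; case: #|H| cardH => [|[|n]] // _; rewrite !subSS !subn0 ltnn.
by rewrite s0 subn0 mul0n addn0.
Qed.
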